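(* Let $d\in\{2,3\}$, $\overline{\varkappa}\in\mathbb{R}$, $T>0$, $M\in\mathbb{N}$, $\Delta t=T/M$, and let $(\mathscr{V}^{m+1},\varkappa^{m+1},\vec X^{m+1},\kappa^{m+1})$, $m=0,1,\dots,M-1$, be a solution of the fully discrete two-stage scheme described in the context, with the corresponding polyhedral surfaces $\Gamma^m$. Then for $m=0,1,\dots,M-1$ it holds that $$\frac12\|\varkappa^{m+1}-\overline{\varkappa}\|_m^2+\Delta t\,\|\mathscr{V}^{m+1}\|_m^2\le\frac12\|\varkappa^m-\overline{\varkappa}\|_{m-1}^2,$$ where $\|\cdot\|_m$ is the norm induced by the $L^2$-inner product $(\cdot,\cdot)_{\Gamma^m}$ on $\Gamma^m$ (with $\Gamma^{-1}=\Gamma^0$).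
   Context: Polyhedral surfaces. Each $\Gamma^m=\bigcup_{j=1}^J\overline{\sigma^m_j}\subset\mathbb{R}^d$ is an oriented $(d-1)$-dimensional polyhedral surface, with or without boundary; $\mathscr{T}^m=\{\sigma_j^m\}_{j=1}^J$ is a collection of mutually disjoint (open) nondegenerate $(d-1)$-simplices forming a conforming triangulation, with set of vertices $\mathcal{Q}^m=\{\vec q_k^m\}_{k=1}^K$. The boundary, which is fixed in time, is partitioned disjointly as $\partial\Gamma^m=\partial_1\Gamma^m\cup\partial_2\Gamma^m$ with $\partial_\alpha\Gamma^m=\partial_\alpha\Gamma^0$ (either part may be empty). If $\vec q^m_{j_0},\dots,\vec q^m_{j_{d-1}}$ are the vertices of $\sigma_j^m$, consistently oriented, then the orientation vector is $\vec N\{\sigma_j^m\}=(\vec q^m_{j_1}-\vec q^m_{j_0})\wedge\dots\wedge(\vec q^m_{j_{d-1}}-\vec q^m_{j_0})$ (the cross product if $d=3$; the rotation of the single edge vector by $90^\circ$, with a fixed sense, if $d=2$), and the piecewise constant unit normal is $\vec\nu^m|_{\sigma_j^m}=\vec N\{\sigma^m_j\}/|\vec N\{\sigma^m_j\}|$. $\nabla_s$ is the surface gradient (simplexwise), $\vec{\rm id}$ the identity function. Spaces. $\mathbb{V}^h(\Gamma^m)$: continuous functions on $\Gamma^m$ that are affine on each $\sigma\in\mathscr{T}^m$. For $\alpha=1,2$: $\mathbb{V}^h_{\partial_\alpha}(\Gamma^m)=\{\chi\in\mathbb{V}^h(\Gamma^m):\chi=0\text{ on }\partial_\alpha\Gamma^m\}$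 and $\mathbb{K}^h_{\partial_\alpha}(\Gamma^m)=\{\chi\in\mathbb{V}^h(\Gamma^m):\chi=\overline{\varkappa}\text{ on }\partial_\alpha\Gamma^m\}$. Further $\mathbb{V}_0^h=\mathbb{V}^h_{\partial_1}\cap\mathbb{V}^h_{\partial_2}$ and $\mathbb{K}^h_{\overline{\varkappa}}=\mathbb{K}^h_{\partial_1}\cap\mathbb{K}^h_{\partial_2}$. Inner products. $(\cdot,\cdot)_{\Gamma^m}$ is the $L^2$-inner product on $\Gamma^m$; the mass-lumped inner product of piecewise continuous $u,v$ is $(u,v)^h_{\Gamma^m}=\frac1d\sum_{j=1}^J\mathcal{H}^{d-1}(\sigma_j^m)\sum_{k=0}^{d-1}\lim_{\sigma_j^m\ni\vec p\to\vec q^m_{j_k}}(u\cdot v)(\vec p)$. Vertex normals. $\vec\omega^m\in[\mathbb{V}^h(\Gamma^m)]^d$ is defined by $(\vec\omega^m,\vec\eta^h)^h_{\Gamma^m}=(\vec\nu^m,\vec\eta^h)^h_{\Gamma^m}$ for all $\vec\eta^h\in[\mathbb{V}^h(\Gamma^m)]^d$, and is assumed nonzero at every vertex. $\mathcal{W}^m=|\nabla_s\vec v^m|^2$ (squared Frobenius norm), where $\vec v^m\in[\mathbb{V}^h(\Gamma^m)]^d$ has vertex values $\vec v^m(\vec q)=\vec\omega^m(\vec q)/|\vec\omega^m(\vec q)|$, $\vec q\in\mathcal{Q}^m$. Velocity and Jacobian. $\vec{\mathscr{V}}^m\in[\mathbb{V}^h(\Gamma^m)]^d$ is given by $\vec{\mathscr{V}}^m(\vec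 q_k^m)=(\vec q_k^m-\vec q_k^{m-1})/\Delta t$, and $\vec\Phi^m=\vec{\rm id}-\Delta t\,\vec{\mathscr{V}}^m$, so that $\vec\Phi^m(\vec q_k^m)=\vec q_k^{m-1}$ and $\vec\Phi^m(\Gamma^m)=\Gamma^{m-1}$. $\mathcal{J}^m=\sqrt{\det\mathcal{L}^m}$ is the surface Jacobian determinant of $\vec\Phi^m$, where $\mathcal{L}^m$ is the linear operator on the tangent space of $\Gamma^m$ induced by $[\nabla_s\vec\Phi^m]^T\nabla_s\vec\Phi^m$. Antisymmetric form: $\mathscr{A}_\Gamma(\vec\eta,u,v)=(\vec\eta\cdot\nabla_su,v)_\Gamma-(\vec\eta\cdot\nabla_sv,u)_\Gamma$. The scheme. Given the nondegenerate initial polyhedral surface $\Gamma^0$ and $\varkappa^0_{\Gamma^0}:=\varkappa^0\in\mathbb{K}^h_{\overline{\varkappa}}(\Gamma^0)$, set $\Gamma^{-1}=\Gamma^0$ (so $\vec{\mathscr{V}}^0=\vec0$) and $\mathcal{J}^0=1$. For $m\ge0$: Stage 1. Find $(\mathscr{V}^{m+1},\varkappa^{m+1})\in\mathbb{V}^h_0(\Gamma^m)\times\mathbb{K}^h_{\partial_1}(\Gamma^m)$ such that for all $(\varphi^h,\chi^h)\in\mathbb{V}_0^h(\Gamma^m)\times\mathbb{V}^h_{\partial_1}(\Gamma^m)$ $$\begin{aligned}&(\mathscr{V}^{m+1},\varphi^h)_{\Gamma^m}-(\nabla_s\varkappa^{m+1},\nabla_s\varphi^h)_{\Gamma^m}+(\mathcal{W}^m[\varkappa^{m+1}-\overline{\varkappa}],\varphi^h)_{\Gamma^m}-\tfrac12\big([\varkappa^m_{\Gamma^m}-\overline{\varkappa}]\varkappa^m_{\Gamma^m}[\varkappa^{m+1}-\overline{\varkappa}],\varphi^h\big)_{\Gamma^m}=0,\\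 &\Big(\frac{\varkappa^{m+1}-\overline{\varkappa}-(\varkappa^m_{\Gamma^m}-\overline{\varkappa})\sqrt{\mathcal{J}^m}}{\Delta t},\chi^h\Big)_{\Gamma^m}-\tfrac12\mathscr{A}_{\Gamma^m}(\vec{\mathscr{V}}^m,\varkappa^{m+1}-\overline{\varkappa},\chi^h)+(\nabla_s\mathscr{V}^{m+1},\nabla_s\chi^h)_{\Gamma^m}\\&\qquad-(\mathcal{W}^m\mathscr{V}^{m+1},\chi^h)_{\Gamma^m}+\tfrac12\big(\mathscr{V}^{m+1},[\varkappa^m_{\Gamma^m}-\overline{\varkappa}]\varkappa^m_{\Gamma^m}\chi^h\big)_{\Gamma^m}=0.\end{aligned}$$ Stage 2. Find $\kappa^{m+1}\in\mathbb{K}^h_{\overline{\varkappa}}(\Gamma^m)$ and $\vec X^{m+1}\in[\mathbb{V}^h(\Gamma^m)]^d$ with $\vec X^{m+1}-\vec{\rm id}\in[\mathbb{V}^h_0(\Gamma^m)]^d$ such that for all $(\xi^h,\vec\eta^h)\in\mathbb{V}^h_0(\Gamma^m)\times[\mathbb{V}^h_0(\Gamma^m)]^d$ $$\Big(\frac{\vec X^{m+1}-\vec{\rm id}}{\Delta t}\cdot\vec\nu^m,\xi^h\Big)^h_{\Gamma^m}-(\mathscr{V}^{m+1},\xi^h)_{\Gamma^m}=0,\qquad(\kappa^{m+1}\vec\nu^m,\vec\eta^h)^h_{\Gamma^m}+(\nabla_s\vec X^{m+1},\nabla_s\vec\eta^h)_{\Gamma^m}=0.$$ Then set $\Gamma^{m+1}=\vec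 X^{m+1}(\Gamma^m)$, with vertices $\vec q_k^{m+1}=\vec X^{m+1}(\vec q_k^m)$, and $\varkappa^{m+1}_{\Gamma^{m+1}}=\varkappa^{m+1}\circ\vec\Phi^{m+1}\in\mathbb{K}^h_{\partial_1}(\Gamma^{m+1})$. Note that $\varkappa^{m+1}$ is a function on $\Gamma^m$. *)

(* Defs.v *)
From HB Require Import structures.
From mathcomp Require Import all_boot all_order all_algebra all_fingroup.
From mathcomp Require Import all_classical all_reals all_analysis.
Set Implicit Arguments.
Unset Strict Implicit.
Unset Printing Implicit Defensive.
Import Order.TTheory GRing.Theory Num.Theory.
Import numFieldNormedType.Exports.
Local Open Scope classical_set_scope.
Local Open Scope ring_scope.

(* The ambient space R^d is 'rV[R]_n.+1: d = n.+1, and n = d - 1 is the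
   dimension of the surfaces. *)

(* Euclidean inner product of vectors, Frobenius inner product of matrices.
   The library's `|x| on matrices is the sup norm, hence [enorm]. *)
Definition mdot (R : realType) (a b : nat) (A B : 'M[R]_(a, b)) : R :=
  \tr (A *m B^T).

Definition enorm (R : realType) (a b : nat) (A : 'M[R]_(a, b)) : R :=
  Num.sqrt (mdot A A).

(* K labelled vertices and J labelled simplices; [vtx S j] lists the vertices
   of the j-th simplex in the order that defines its orientation. *)
Record surface (R : realType) (n K J : nat) := Surface {
  vtx : 'I_J -> 'I_n.+1 -> 'I_K ;
  pos : 'I_K -> 'rV[R]_n.+1
}.

Definition image_surface (R : realType) (n K J : nat)
    (X : 'rV[R]_n.+1 -> 'rV[R]_n.+1) (S : surface R n K J) : surface R n K J :=
  Surface (vtx S) (fun k => X (pos S k)).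

Section Geometry.
Variables (R : realType) (n K J : nat) (S : surface R n K J).

Definition verts (j : 'I_J) : {set 'I_K} := [set vtx S j a | a : 'I_n.+1].

Definition closed_hull (F : {set 'I_K}) : set 'rV[R]_n.+1 :=
  [set p | exists l : 'I_K -> R,
    [/\ forall k, k \in F -> 0 <= l k,
        \sum_(k in F) l k = 1
      & p = \sum_(k in F) l k *: pos S k]].

Definition open_hull (F : {set 'I_K}) : set 'rV[R]_n.+1 :=
  [set p | exists l : 'I_K -> R,
    [/\ forall k, k \in F -> 0 < l k,
        \sum_(k in F) l k = 1
      & p = \sum_(k in F) l k *: pos S k]].

Definition osimplex (j : 'I_J) : set 'rV[R]_n.+1 := open_hull (verts j).
Definition csimplex (j : 'I_J) : set 'rV[R]_n.+1 := closed_hull (verts j).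

Definition support_set : set 'rV[R]_n.+1 :=
  [set p | exists j, csimplex j p].

(* Number of simplices containing the (n-1)-dimensional face F. *)
Definition face_degree (F : {set 'I_K}) : nat :=
  #|[set j : 'I_J | F \subset verts j]|.

Definition boundary : set 'rV[R]_n.+1 :=
  [set p | exists F : {set 'I_K},
    [/\ #|F| = n, face_degree F = 1%N & closed_hull F p]].

Definition edges (j : 'I_J) : 'M[R]_(n, n.+1) :=
  \matrix_(i < n) (pos S (vtx S j (lift ord0 i)) - pos S (vtx S j ord0)).

Definition nondegenerate : Prop :=
  injective (pos S) /\
  forall j, injective (vtx S j) /\ row_free (edges j).

Definition conforming : Prop :=
  [/\ forall k, exists j, k \in verts j,
      forall i j, i != j -> osimplex i `&` osimplex j = set0
    & forall i j, csimplex i `&` csimplex j =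
                  closed_hull (verts i :&: verts j)].

(* Combinatorial manifold with boundary (for n = 1, 2): each (n-1)-face has
   degree at most two and the star of each vertex is connected through
   (n-1)-faces containing that vertex, i.e. its link is a path or a cycle
   when n = 2. *)
Definition manifold : Prop :=
  (forall F : {set 'I_K}, #|F| = n -> (face_degree F <= 2)%N) /\
  (forall k i j, k \in verts i -> k \in verts j ->
     connect (fun a b : 'I_J =>
       [&& k \in verts a, k \in verts b & #|verts a :&: verts b| == n]) i j).

(* Two simplices sharing an (n-1)-face induce opposite orientations on it:
   replacing in the ordered simplex i the vertex opposite to the common face
   by the one of j yields an odd reordering of the simplex j. *)
Definition consistently_oriented : Prop :=
  forall (i j : 'I_J) (a : 'I_n.+1) (s : 'S_n.+1), i != j ->
    (forall b, b != a -> vtx S i b = vtx S j (s b)) -> odd_perm s.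

Definition polyhedral_surface : Prop :=
  [/\ nondegenerate, conforming, manifold & consistently_oriented].

(* v_1 /\ ... /\ v_n: the cross product if n = 2, a rotation by 90 degrees
   if n = 1. *)
Definition wedge (E : 'M[R]_(n, n.+1)) : 'rV[R]_n.+1 :=
  \row_i \det (col_mx (delta_mx 0 i : 'rV[R]_n.+1) E : 'M[R]_n.+1).

Definition orientation_vector (j : 'I_J) : 'rV[R]_n.+1 := wedge (edges j).

Definition unit_normal (j : 'I_J) : 'rV[R]_n.+1 :=
  (enorm (orientation_vector j))^-1 *: orientation_vector j.

Definition gram (j : 'I_J) : 'M[R]_n := edges j *m (edges j)^T.

(* n-dimensional Hausdorff measure of the simplex j. *)
Definition area (j : 'I_J) : R := Num.sqrt (\det (gram j)) / n`!%:R.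

End Geometry.

(* Integral over the open simplex {x in R^m : x_i > 0, sum_i x_i < s}, as an
   iterated Lebesgue integral; the list collects the coordinates. *)
Fixpoint std_simplex_int (R : realType) (m : nat) (s : R) (f : seq R -> R) : R :=
  match m with
  | 0%N => f [::]
  | m'.+1 => Rintegral (@lebesgue_measure R) `]0, s[
      (fun x => std_simplex_int m' (s - x) (fun y => f (x :: y)))
  end.

Section Calculus.
Variables (R : realType) (n K J : nat) (S : surface R n K J).

(* Affine parametrization of the simplex j by the reference simplex. *)
Definition param (j : 'I_J) (x : seq R) : 'rV[R]_n.+1 :=
  pos S (vtx S j ord0) + (\row_(i < n) x`_i) *m edges S j.

(* Surface integral over Gamma of a function given simplexwise. *)
Definition sint (f : 'I_J -> 'rV[R]_n.+1 -> R) : R :=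
  \sum_j Num.sqrt (\det (gram S j)) *
    std_simplex_int n 1 (fun x => f j (param j x)).

Definition L2 (u v : 'I_J -> 'rV[R]_n.+1 -> R) : R :=
  sint (fun j p => u j p * v j p).

(* L^2-inner product of vector- or matrix-valued functions. *)
Definition L2m (a b : nat) (u v : 'I_J -> 'rV[R]_n.+1 -> 'M[R]_(a, b)) : R :=
  sint (fun j p => mdot (u j p) (v j p)).

Definition L2norm (u : 'rV[R]_n.+1 -> R) : R :=
  Num.sqrt (L2 (fun=> u) (fun=> u)).

(* Mass-lumped integral; the inner product (u, v)^h is [lumped] of u . v. *)
Definition lumped (f : 'I_J -> 'rV[R]_n.+1 -> R) : R :=
  n.+1%:R^-1 * \sum_j area S j *
    \sum_(a < n.+1)
      lim (f j @ within (osimplex S j) (nbhs (pos S (vtx S j a)))).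

(* Surface gradient at p in the open simplex j: the tangential vector
   sum_(i, k) g^(i k) ('D_(e_k) u p) e_i, with e_i the edge vectors. *)
Definition sgrad (u : 'rV[R]_n.+1 -> R) (j : 'I_J) (p : 'rV[R]_n.+1) :
    'rV[R]_n.+1 :=
  (\row_(i < n) 'D_(row i (edges S j)) u p) *m invmx (gram S j) *m edges S j.

(* Row i of the surface Jacobian is the surface gradient of component i. *)
Definition sjac (u : 'rV[R]_n.+1 -> 'rV[R]_n.+1) (j : 'I_J)
    (p : 'rV[R]_n.+1) : 'M[R]_n.+1 :=
  \matrix_(i < n.+1) sgrad (fun y => u y 0 i) j p.

(* Matrix, in the basis of edge vectors, of the operator induced on the
   tangent space of the simplex j by a matrix A acting on column vectors. *)
Definition tangent_mx (j : 'I_J) (A : 'M[R]_n.+1) : 'M[R]_n :=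
  invmx (gram S j) *m (edges S j *m A *m (edges S j)^T).

Definition sjacobian_det (u : 'rV[R]_n.+1 -> 'rV[R]_n.+1) (j : 'I_J)
    (p : 'rV[R]_n.+1) : R :=
  Num.sqrt (\det (tangent_mx j ((sjac u j p)^T *m sjac u j p))).

Definition antisym (eta : 'rV[R]_n.+1 -> 'rV[R]_n.+1)
    (u v : 'rV[R]_n.+1 -> R) : R :=
  L2 (fun j p => mdot (eta p) (sgrad u j p)) (fun=> v) -
  L2 (fun j p => mdot (eta p) (sgrad v j p)) (fun=> u).

(* Elements of V^h(Gamma) are represented by functions on the ambient space,
   of which only the values on Gamma matter. *)
Definition Vh : set ('rV[R]_n.+1 -> R) :=
  [set u | {within support_set S, continuous u} /\
    forall j, exists (a : 'rV[R]_n.+1) (b : R),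
      forall p, osimplex S j p -> u p = mdot a p + b].

Definition Vh_on (D : set 'rV[R]_n.+1) : set ('rV[R]_n.+1 -> R) :=
  [set u | Vh u /\ forall p, D p -> u p = 0].

Definition Kh_on (kbar : R) (D : set 'rV[R]_n.+1) : set ('rV[R]_n.+1 -> R) :=
  [set u | Vh u /\ forall p, D p -> u p = kbar].

(* [vec A] is A^d. *)
Definition vec (A : set ('rV[R]_n.+1 -> R)) :
    set ('rV[R]_n.+1 -> 'rV[R]_n.+1) :=
  [set u | forall i, A (fun p => u p 0 i)].

End Calculus.

(* At index m, [omega], [vn] and [vel] are functions on Gamma^m, whereas [vk],
   [V], [X] and [kap] are functions on Gamma^(m-1), with Gamma^(-1) = Gamma^0;
   [V 0], [X 0] and [kap 0] are never used. *)
Record scheme_data (R : realType) (n K J : nat) := SchemeData {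
  Gam   : nat -> surface R n K J ;
  vk    : nat -> 'rV[R]_n.+1 -> R ;             (* \varkappa *)
  V     : nat -> 'rV[R]_n.+1 -> R ;             (* scalar normal velocity *)
  X     : nat -> 'rV[R]_n.+1 -> 'rV[R]_n.+1 ;
  kap   : nat -> 'rV[R]_n.+1 -> R ;             (* \kappa *)
  omega : nat -> 'rV[R]_n.+1 -> 'rV[R]_n.+1 ;
  vn    : nat -> 'rV[R]_n.+1 -> 'rV[R]_n.+1 ;   (* normalized omega *)
  vel   : nat -> 'rV[R]_n.+1 -> 'rV[R]_n.+1     (* velocity field *)
}.

Section Scheme.
Variables (R : realType) (n K J : nat).
Variables (kbar dt : R) (D1 D2 : set 'rV[R]_n.+1) (s : scheme_data R n K J).
Notation E := 'rV[R]_n.+1.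
Implicit Types (m : nat).

Definition V0h (S : surface R n K J) : set (E -> R) :=
  Vh_on S D1 `&` Vh_on S D2.
Definition Kh (S : surface R n K J) : set (E -> R) :=
  Kh_on S kbar D1 `&` Kh_on S kbar D2.

Definition admissible_surface m : Prop :=
  polyhedral_surface (Gam s m) /\ boundary (Gam s m) = D1 `|` D2.

Definition is_vertex_normal m : Prop :=
  [/\ vec (Vh (Gam s m)) (omega s m),
      forall eta, vec (Vh (Gam s m)) eta ->
        lumped (Gam s m) (fun _ p => mdot (omega s m p) (eta p)) =
        lumped (Gam s m)
          (fun j p => mdot (unit_normal (Gam s m) j) (eta p))
    & forall k, omega s m (pos (Gam s m) k) != 0].

Definition is_normalized_normal m : Prop :=
  vec (Vh (Gam s m)) (vn s m) /\
  forall k, vn s m (pos (Gam s m) k) =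
    (enorm (omega s m (pos (Gam s m) k)))^-1 *: omega s m (pos (Gam s m) k).

Definition Wm m (j : 'I_J) (p : E) : R := enorm (sjac (Gam s m) (vn s m) j p) ^+ 2.

(* Since 0.-1 = 0, this includes the convention Gamma^(-1) = Gamma^0. *)
Definition is_velocity m : Prop :=
  vec (Vh (Gam s m)) (vel s m) /\
  forall k, vel s m (pos (Gam s m) k) =
    dt^-1 *: (pos (Gam s m) k - pos (Gam s m.-1) k).

Definition Phi m (p : E) : E := p - dt *: vel s m p.

Definition Jac m (j : 'I_J) (p : E) : R :=
  if m is 0%N then 1 else sjacobian_det (Gam s m) (Phi m) j p.

(* \varkappa^m transported to Gamma^m. *)
Definition vkG m (p : E) : R :=
  if m is 0%N then vk s 0 p else vk s m (Phi m p).

Definition stage1 m : Prop :=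
  let G := Gam s m in
  let V' := V s m.+1 in
  let k' := vk s m.+1 in
  [/\ V0h G V',
      Kh_on G kbar D1 k',
      forall phi, V0h G phi ->
        L2 G (fun=> V') (fun=> phi)
        - L2m G (sgrad G k') (sgrad G phi)
        + L2 G (fun j p => Wm m j p * (k' p - kbar)) (fun=> phi)
        - 2^-1 * L2 G (fun _ p => (vkG m p - kbar) * vkG m p * (k' p - kbar))
                      (fun=> phi) = 0
    & forall chi, Vh_on G D1 chi ->
        L2 G (fun j p =>
               (k' p - kbar - (vkG m p - kbar) * Num.sqrt (Jac m j p)) / dt)
             (fun=> chi)
        - 2^-1 * antisym G (vel s m) (fun p => k' p - kbar) chi
        + L2m G (sgrad G V') (sgrad G chi)
        - L2 G (fun j p => Wm m j p * V' p) (fun=> chi)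
        + 2^-1 * L2 G (fun=> V')
                      (fun _ p => (vkG m p - kbar) * vkG m p * chi p) = 0].

Definition stage2 m : Prop :=
  let G := Gam s m in
  let V' := V s m.+1 in
  let X' := X s m.+1 in
  let kap' := kap s m.+1 in
  [/\ Kh G kap',
      vec (Vh G) X',
      vec (V0h G) (fun p => X' p - p),
      forall xi, V0h G xi ->
        lumped G (fun j p =>
          mdot (dt^-1 *: (X' p - p)) (unit_normal G j) * xi p)
        - L2 G (fun=> V') (fun=> xi) = 0
    & forall eta, vec (V0h G) eta ->
        lumped G (fun j p => mdot (kap' p *: unit_normal G j) (eta p))
        + L2m G (sjac G X') (sjac G eta) = 0].

Definition scheme_solution (M : nat) : Prop :=
  [/\ D1 `&` D2 = set0,
      Kh (Gam s 0) (vk s 0)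
    & forall m, (m < M)%N ->
      [/\ admissible_surface m,
          is_vertex_normal m /\ is_normalized_normal m,
          is_velocity m,
          stage1 m /\ stage2 m
        & Gam s m.+1 = image_surface (X s m.+1) (Gam s m)]].

End Scheme.

(* Main.v *)
Require Import Defs.
From mathcomp Require Import all_boot all_order all_algebra.
From mathcomp Require Import all_classical all_reals all_analysis.
From mathcomp Require Import ring lra.
Import Order.TTheory GRing.Theory Num.Theory.
Import numFieldNormedType.Exports.
Local Open Scope classical_set_scope.
Local Open Scope ring_scope.
Set Implicit Arguments.
Unset Strict Implicit.
Unset Printing Implicit Defensive.

(** Write [chi] for the new curvature deviation [vk s m.+1 - kbar] and [g] for
    the old one, transported to the current surface [Gam s m].

    Test the two equations of the first stage with the new velocity [V] and
    with [chi].  Both are admissible: [V] vanishes on the whole boundary and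
    [chi] on its first part.  On adding the two equations, the gradient terms,
    the Willmore terms and the cubic terms cancel in pairs, and the
    antisymmetric form vanishes on the diagonal ([energy_identity]).  What
    remains is
      ((chi - g sqrt J) / dt, chi) + (V, V) = 0.
    By Young's inequality, (g sqrt J, chi) is at most half of (chi, chi) plus
    half of (J g, g), and the change of variables by [Phi] turns (J g, g) into
    the squared norm of the old deviation on the previous surface.

    Two points carry the analysis. First, Young's inequality is integrated, by
    linearity and monotonicity of the iterated integral over the reference
    simplex; both rest on the integrability of every inner integral. All
    integrands are polynomial in the reference coordinates, and the iterated
    integral of a monomial over the simplex of size [s] is a constant times a
    power of [s] ([std_simplex_int_monomial]), which makes the induction on
    the dimension work. Second, the change of variables reduces to a pointwise
    statement, because [Phi] maps each simplex affinely onto its predecessor: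
    it carries one parametrization to the other ([param_image]), and its
    surface Jacobian is the quotient of the square roots of the two Gram
    determinants ([area_image]). *)

(** * Iterated integrals over the reference simplex *)

Section Integration.
Context {R : realType}.
Implicit Types (s : R) (f g : seq R -> R) (m : nat) (y : seq R).
Local Notation mu := (@lebesgue_measure R).

Definition open_std_simplex m s : set (seq R) :=
  [set y | [/\ size y = m, all (> 0) y & \sum_(t <- y) t < s]].

Lemma open_std_simplex_cons m s (x : R) y : `]0, s[%classic x ->
  open_std_simplex m (s - x) y -> open_std_simplex m.+1 s (x :: y).
Proof.
rewrite /= in_itv/= => /andP[x0 _] [szy y0 ys]; split; rewrite /= ?szy//.
  by rewrite x0 y0.
by rewrite big_cons -ltrBrDl.
Qed.

Lemma subr_itv_gt0 s (x : R) : `]0, s[%classic x -> 0 < s - x.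
Proof. by rewrite /= in_itv/= subr_gt0 => /andP[]. Qed.

Lemma eq_std_simplex_int m s f g : 0 < s ->
  (forall y, open_std_simplex m s y -> f y = g y) ->
  std_simplex_int m s f = std_simplex_int m s g.
Proof.
elim: m s f g => [|m IHm] s f g s0 fg /=.
  by apply: fg; split; rewrite ?big_nil.
apply: eq_Rintegral => x /set_mem xs.
apply: (IHm _ _ _ (subr_itv_gt0 xs)) => y ys.
by apply: fg; exact: open_std_simplex_cons.
Qed.

Lemma std_simplex_int_ge0 m s f : 0 < s ->
  (forall y, open_std_simplex m s y -> 0 <= f y) ->
  0 <= std_simplex_int m s f.
Proof.
elim: m s f => [|m IHm] s f s0 f0 /=.
  by apply: f0; split; rewrite ?big_nil.
apply: Rintegral_ge0 => x xs.
apply: (IHm _ _ (subr_itv_gt0 xs)) => y ys.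
by apply: f0; exact: open_std_simplex_cons.
Qed.

(** Linearity of an iterated integral can fail without integrability at every
    level; the two conjuncts are exactly what each step of the recursion in
    [std_simplex_int] consumes. *)
Fixpoint iter_integrable m s f : Prop :=
  if m is m'.+1 then
    (forall x, `]0, s[%classic x ->
       iter_integrable m' (s - x) (fun y => f (x :: y))) /\
    mu.-integrable `]0, s[
      (EFin \o (fun x => std_simplex_int m' (s - x) (fun y => f (x :: y))))
  else True.

Lemma eq_iter_integrable m s f g : 0 < s ->
  (forall y, open_std_simplex m s y -> f y = g y) ->
  iter_integrable m s f -> iter_integrable m s g.
Proof.
elim: m s f g => [//|m IHm] s f g s0 fg /= [fi fint].
have fgx x : `]0, s[%classic x -> forall y,
    open_std_simplex m (s - x) y -> f (x :: y) = g (x :: y).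
  by move=> xs y ys; apply: fg; exact: open_std_simplex_cons.
split=> [x xs|].
  exact: (IHm _ _ _ (subr_itv_gt0 xs) (fgx _ xs) (fi _ xs)).
apply: eq_integrable fint => // x /set_mem xs /=; congr EFin.
exact: eq_std_simplex_int (subr_itv_gt0 xs) (fgx _ xs).
Qed.

Lemma std_simplex_int_linear m s (a : R) f g : 0 < s ->
  iter_integrable m s f -> iter_integrable m s g ->
  iter_integrable m s (fun y => a * f y + g y) /\
  std_simplex_int m s (fun y => a * f y + g y) =
  a * std_simplex_int m s f + std_simplex_int m s g.
Proof.
elim: m s f g => [//|m IHm] s f g s0 /= [fi Fint] [gi Gint].
pose F x := std_simplex_int m (s - x) (fun y => f (x :: y)).
pose G x := std_simplex_int m (s - x) (fun y => g (x :: y)).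
have step x : `]0, s[%classic x -> std_simplex_int m (s - x)
    (fun y => a * f (x :: y) + g (x :: y)) = a * F x + G x.
  by move=> xs; have [] := IHm _ _ _ (subr_itv_gt0 xs) (fi _ xs) (gi _ xs).
have aFint : mu.-integrable `]0, s[ (EFin \o (fun x => a * F x)).
  rewrite (_ : _ \o _ = (fun x => a%:E * (EFin \o F) x)%E); last first.
    by apply/funext => x /=; rewrite EFinM.
  exact: integrableZl.
split; first split=> [x xs|].
- by have [] := IHm _ _ _ (subr_itv_gt0 xs) (fi _ xs) (gi _ xs).
- have aFGint := integrableD _ aFint Gint.
  apply: eq_integrable (aFGint _) => // x /set_mem xs /=.
  by rewrite step// EFinD.
- transitivity (Rintegral mu `]0, s[ (fun x => a * F x + G x)).
    by apply: eq_Rintegral => x /set_mem xs; rewrite step.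
  by rewrite RintegralD// RintegralZl.
Qed.

Lemma le_std_simplex_int m s f g : 0 < s ->
  iter_integrable m s f -> iter_integrable m s g ->
  (forall y, open_std_simplex m s y -> f y <= g y) ->
  std_simplex_int m s f <= std_simplex_int m s g.
Proof.
move=> s0 fi gi fg.
have [_ e] := std_simplex_int_linear (-1) s0 fi gi.
rewrite -subr_ge0 addrC -mulN1r -e; apply: std_simplex_int_ge0 => // y ys.
by rewrite mulN1r addrC subr_ge0 fg.
Qed.

Lemma poly_antiderivative (q : {poly R}) : exists Q : {poly R}, Q^`() = q.
Proof.
exists (\poly_(i < (size q).+1) (q`_i.-1 / i%:R)); apply/polyP => i.
rewrite coef_deriv coef_poly ltnS; case: ltnP => [iq|qi] /=.
  by rewrite -mulrnAr -[X in X *+ _]mul1r -mulrnAl divff ?mulr1 ?pnatr_eq0.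
by rewrite mul0rn nth_default.
Qed.

Lemma integrable_horner s (I : interval R) (p : {poly R}) :
  [set` I] `<=` `[0, s] -> mu.-integrable [set` I] (EFin \o horner p).
Proof.
move=> Is; apply: (@integrableS _ _ _ mu `[0, s]) => //.
apply: continuous_compact_integrable; first exact: segment_compact.
by apply: continuous_subspaceT; exact: continuous_horner.
Qed.

Lemma Rintegral_horner_deriv s (P : {poly R}) : 0 < s ->
  Rintegral mu `]0, s[ (horner P^`()) = P.[s] - P.[0].
Proof.
move=> s0; have Pint (I : interval R) : [set` I] `<=` `[0, s] ->
  mu.-integrable [set` I] (EFin \o horner P^`()) := integrable_horner _.
rewrite Rintegral_itv_bndo_bndc; last by apply: Pint; exact: subset_itv_oo_cc.
rewrite Rintegral_itv_obnd_cbnd; last first.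
  by apply: Pint; apply: subset_itvr; rewrite bnd_simp.
rewrite /Rintegral (@continuous_FTC2 _ _ (horner P)) //.
- by apply: continuous_subspaceT; exact: continuous_horner.
- split=> [x _| |].
  + exact: derivable_horner.
  + by apply: cvg_at_right_filter; exact: continuous_horner.
  + by apply: cvg_at_left_filter; exact: continuous_horner.
- by move=> x _; exact: (congr1 (@^~ x) (esym (derivE P))).
Qed.

(** From [a = (a - 1) + 1], using [f] itself as the second integrand. *)
Lemma std_simplex_intZ m s (a : R) f : 0 < s -> iter_integrable m s f ->
  iter_integrable m s (fun y => a * f y) /\
  std_simplex_int m s (fun y => a * f y) = a * std_simplex_int m s f.
Proof.
move=> s0 fi; have [] := std_simplex_int_linear (a - 1) s0 fi fi.
rewrite (_ : (fun _ => _) = fun y => a * f y); last first.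
  by apply/funext => y; rewrite mulrBl mul1r subrK.
by move=> ai ->; rewrite mulrBl mul1r subrK.
Qed.

(** The substitution [x = s t] turns the left-hand side into a power of [s]
    times the Beta integral of [t ^+ a * (1 - t) ^+ b] over the unit interval,
    computed here from a polynomial antiderivative. *)
Lemma Rintegral_beta (a b : nat) : exists C : R, forall s, 0 < s ->
  Rintegral mu `]0, s[ (fun x => x ^+ a * (s - x) ^+ b) = C * s ^+ (a + b).+1.
Proof.
have [Q Q'E] := poly_antiderivative ('X^a * (1 - 'X) ^+ b).
exists (Q.[1] - Q.[0]) => s s0; have sn0 : s != 0 by rewrite gt_eqF.
(* the antiderivative Q after the change of variable x = s t *)
pose P := s ^+ (a + b).+1 *: (Q \Po (s^-1 *: 'X)).
have P'E x : P^`().[x] = x ^+ a * (s - x) ^+ b.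
  rewrite derivZ deriv_comp Q'E derivZ derivX !hornerE horner_comp !hornerE.
  rewrite (_ : 1 - s^-1 * x = s^-1 * (s - x)); last by field.
  rewrite !exprMn exprS exprD !exprVn /=; field.
  by rewrite ?expf_neq0 ?sn0.
transitivity (Rintegral mu `]0, s[ (horner P^`())).
  by apply: eq_Rintegral => x _; rewrite -P'E.
rewrite Rintegral_horner_deriv// /P !hornerZ !horner_comp !hornerE mulVf//.
by rewrite ?mulr0; ring.
Qed.

Definition monomial_fun m (e : nat -> nat) y : R := \prod_(i < m) y`_i ^+ e i.

(** Homogeneity is what the induction needs: slicing at [x] leaves
    a constant times [x ^+ a * (s - x) ^+ b], which is again integrable and
    whose integral is again a constant times a power of [s]. *)
Lemma std_simplex_int_monomial m e : exists C N, forall s, 0 < s ->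
  iter_integrable m s (monomial_fun m e) /\
  std_simplex_int m s (monomial_fun m e) = C * s ^+ N.
Proof.
elim: m e => [|m IHm] e.
  by exists 1, 0%N => s _; split=> //=; rewrite /monomial_fun big_ord0 mul1r.
have [C [N IH]] := IHm (fun i => e i.+1).
have [B BE] := Rintegral_beta (e 0%N) N.
exists (C * B), (e 0%N + N).+1 => s s0.
have slice x : `]0, s[%classic x ->
    iter_integrable m (s - x) (fun y => monomial_fun m.+1 e (x :: y)) /\
    std_simplex_int m (s - x) (fun y => monomial_fun m.+1 e (x :: y)) =
    C * (x ^+ e 0%N * (s - x) ^+ N).
  move=> xs; have [i I] := IH _ (subr_itv_gt0 xs).
  have [] := std_simplex_intZ (x ^+ e 0%N) (subr_itv_gt0 xs) i.
  rewrite (_ : (fun _ => _) = fun y => monomial_fun m.+1 e (x :: y)).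
    by move=> ? ->; split=> //; rewrite I mulrCA.
  by apply/funext => y; rewrite /monomial_fun big_ord_recl.
have hE x : (C%:P * ('X^(e 0%N) * (s%:P - 'X) ^+ N)).[x] =
    C * (x ^+ e 0%N * (s - x) ^+ N) by rewrite !hornerE.
have hint := integrable_horner (C%:P * ('X^(e 0%N) * (s%:P - 'X) ^+ N))
  (@subset_itv_oo_cc _ R 0 s).
split; first split=> [x /slice[]//|].
  by apply: eq_integrable hint => // x /set_mem /slice[_ /= ->]; rewrite hE.
rewrite -mulrA -BE//=.
transitivity (Rintegral mu `]0, s[ (fun x => C * (x ^+ e 0%N * (s - x) ^+ N))).
  by apply: eq_Rintegral => x /set_mem /slice[].
rewrite RintegralZl//.
have := integrable_horner ('X^(e 0%N) * (s%:P - 'X) ^+ N)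
  (@subset_itv_oo_cc _ R 0 s).
by apply: eq_integrable => // x _ /=; rewrite !hornerE.
Qed.

(** Polynomials in the first [m] coordinates are encoded by lists of pairs
    (coefficient, exponents), which makes stability under sums and products
    a matter of concatenating and pairing lists. *)
Definition polynomial_fun m f : Prop := exists l : seq (R * (nat -> nat)),
  forall y, f y = \sum_(t <- l) t.1 * monomial_fun m t.2 y.

Lemma polynomial_fun_integrable m s f : 0 < s -> polynomial_fun m f ->
  iter_integrable m s f.
Proof.
move=> s0 [l /funext ->]; have mi e : iter_integrable m s (monomial_fun m e).
  by have [C [N /(_ s s0)[]]] := std_simplex_int_monomial m e.
elim: l => [|t l IHl].
  have [zi _] := std_simplex_intZ 0 s0 (mi (fun=> 0%N)).
  by apply: eq_iter_integrable zi => // y _; rewrite big_nil mul0r.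
have [ti _] := std_simplex_int_linear t.1 s0 (mi t.2) IHl.
by apply: eq_iter_integrable ti => // y _; rewrite big_cons.
Qed.

Lemma polynomial_funD m f g : polynomial_fun m f -> polynomial_fun m g ->
  polynomial_fun m (fun y => f y + g y).
Proof.
by move=> [l fE] [k gE]; exists (l ++ k) => y; rewrite fE gE big_cat.
Qed.

Lemma polynomial_funM m f g : polynomial_fun m f -> polynomial_fun m g ->
  polynomial_fun m (fun y => f y * g y).
Proof.
move=> [l fE] [k gE].
exists [seq (t.1 * u.1, fun i => (t.2 i + u.2 i)%N) | t <- l, u <- k] => y.
rewrite fE gE big_allpairs_dep mulr_suml; apply: eq_bigr => t _.
rewrite mulr_sumr; apply: eq_bigr => u _ /=.
rewrite mulrACA /monomial_fun -big_split/=; congr (_ * _).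
by apply: eq_bigr => i _; rewrite exprD.
Qed.

Lemma polynomial_fun_cst m c : polynomial_fun m (fun=> c).
Proof.
exists [:: (c, fun=> 0%N)] => y; rewrite big_seq1 /monomial_fun/=.
by rewrite big1 ?mulr1// => i _; rewrite expr0.
Qed.

Lemma polynomial_fun_coord m (i : 'I_m) : polynomial_fun m (fun y => y`_i).
Proof.
exists [:: (1, fun j => (j == i :> nat) : nat)] => y.
rewrite big_seq1 /monomial_fun/= mul1r (bigD1 i)//= eqxx expr1 big1 ?mulr1//.
by move=> j; rewrite -val_eqE => /negbTE/= ->; rewrite expr0.
Qed.

Lemma polynomial_fun_sum m (I : Type) (r : seq I) (F : I -> seq R -> R) :
  (forall i, polynomial_fun m (F i)) ->
  polynomial_fun m (fun y => \sum_(i <- r) F i y).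
Proof.
move=> FP; elim: r => [|i r IHr].
  have [l lE] := polynomial_fun_cst m 0.
  by exists l => y; rewrite big_nil; exact: lE.
have [l lE] := polynomial_funD (FP i) IHr.
by exists l => y; rewrite big_cons; exact: lE.
Qed.

End Integration.

(** * Finite element functions on a simplex *)

Section AffineFunctions.
Context {R : realType} {n K J : nat}.
Implicit Types (S : surface R n K J) (j : 'I_J) (p : 'rV[R]_n.+1).
Implicit Types (u v : 'rV[R]_n.+1 -> R) (b : 'I_n.+1 -> R).

(** [osimplex] is defined with weights on labels of vertices; weights on the
    local indices of the simplex are what the parametrization uses. *)
Lemma osimplexP S j p : injective (vtx S j) ->
  osimplex S j p <-> exists b : 'I_n.+1 -> R,
    [/\ forall a, 0 < b a, \sum_a b a = 1
      & p = \sum_a b a *: pos S (vtx S j a)].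
Proof.
move=> inj; split.
  move=> [l [l0 l1 pE]]; exists (fun a => l (vtx S j a)); split.
  - by move=> a; apply: l0; exact: imset_f.
  - by rewrite -l1 big_imset//= => a a' _ _; exact: inj.
  - by rewrite pE big_imset//= => a a' _ _; exact: inj.
move=> [b [b0 b1 pE]].
(* the sum has a single term, since the labels of the vertices differ *)
pose l k := \sum_(a | vtx S j a == k) b a.
have lE a : l (vtx S j a) = b a.
  by rewrite /l (eq_bigl (pred1 a)) ?big_pred1_eq// => a'; rewrite inj_eq.
exists l; split.
- by move=> k /imsetP[a _ ->]; rewrite lE.
- rewrite big_imset/=; last by move=> a a' _ _; exact: inj.
  by rewrite -b1; apply: eq_bigr => a _; rewrite lE.
- rewrite big_imset/=; last by move=> a a' _ _; exact: inj.
  by rewrite pE; apply: eq_bigr => a _; rewrite lE.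
Qed.

Lemma osimplex_support S j p : osimplex S j p -> support_set S p.
Proof.
by move=> [l [l0 l1 pE]]; exists j, l; split=> // k /l0; exact: ltW.
Qed.

Lemma vertex_support S j a : injective (vtx S j) ->
  support_set S (pos S (vtx S j a)).
Proof.
move=> inj; exists j, (fun k => (k == vtx S j a)%:R); split.
- by move=> k _; rewrite ler0n.
- rewrite (bigD1 (vtx S j a)) ?imset_f//= eqxx big1 ?addr0// => k.
  by move=> /andP[_ /negbTE ->].
- rewrite (bigD1 (vtx S j a)) ?imset_f//= eqxx scale1r big1 ?addr0// => k.
  by move=> /andP[_ /negbTE ->]; rewrite scale0r.
Qed.

Lemma mdotDr (a p q : 'rV[R]_n.+1) : mdot a (p + q) = mdot a p + mdot a q.
Proof. by rewrite /mdot linearD mulmxDr linearD. Qed.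

Lemma mdotZr (c : R) (a p : 'rV[R]_n.+1) : mdot a (c *: p) = c * mdot a p.
Proof. by rewrite /mdot linearZ -scalemxAr linearZ. Qed.

Lemma mdot_sumr (I : Type) (r : seq I) (a : 'rV[R]_n.+1)
    (F : I -> 'rV[R]_n.+1) :
  mdot a (\sum_(i <- r) F i) = \sum_(i <- r) mdot a (F i).
Proof. by rewrite /mdot linear_sum mulmx_sumr linear_sum. Qed.

(** [Vh] prescribes the affine formula in the open simplices only.  Continuity
    along a segment from the barycentre carries it to the vertices. *)
Lemma Vh_affine_vertex S j u (c : 'rV[R]_n.+1) (e : R) : injective (vtx S j) ->
  {within support_set S, continuous u} ->
  (forall p, osimplex S j p -> u p = mdot c p + e) ->
  forall a, u (pos S (vtx S j a)) = mdot c (pos S (vtx S j a)) + e.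
Proof.
move=> inj /subspace_continuousP ucont uE a.
set v := pos S (vtx S j a).
have n0 : n.+1%:R != 0 :> R by rewrite pnatr_eq0.
pose w := \sum_a' (n.+1%:R^-1 : R) *: pos S (vtx S j a').
pose path (t : R) := v + t *: (w - v).
have path_in (t : R) : 0 < t -> t < 1 -> osimplex S j (path t).
  move=> t0 t1; apply/osimplexP => //.
  exists (fun a' => t / n.+1%:R + (1 - t) * (a' == a)%:R); split.
  - move=> a'; apply: ltr_wpDr; first by rewrite mulr_ge0// subr_ge0 ltW.
    by rewrite divr_gt0// ltr0n.
  - rewrite big_split/= sumr_const card_ord -mulr_sumr.
    rewrite (bigD1 a)//= eqxx big1 ?addr0 => [|i /negbTE ->//].
    by rewrite mulr1 -[(t / _) *+ _]mulr_natr divfK// subrKC.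
  - under eq_bigr do rewrite scalerDl -!scalerA.
    rewrite big_split/= -!scaler_sumr.
    rewrite (_ : \sum_a' _ *: _ = v); last first.
      rewrite (bigD1 a)//= eqxx scale1r big1 ?addr0// => i /negbTE ->.
      by rewrite scale0r.
    by rewrite /path /w -scaler_sumr scalerBr scalerBl scale1r addrCA.
have path_v : path t @[t --> 0^'+] --> v.
  apply: cvg_at_right_filter; rewrite -[X in _ --> X]addr0 -(scale0r (w - v)).
  by apply: cvgD; [exact: cvg_cst|apply: cvgZr_tmp; exact: cvg_id].
have near01 : \forall t \near 0^'+, osimplex S j (path t).
  near=> t; apply: path_in; near: t.
    exact: nbhs_right_gt.
  exact: nbhs_right_lt.
have u_v : u (path t) @[t --> 0^'+] --> u v.
  apply: cvg_trans (ucont _ (vertex_support a inj)) => A /= Av.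
  have pathA : \forall t \near 0^'+, support_set S (path t) -> A (u (path t)).
    exact: path_v _ Av.
  by apply: filterS2 pathA near01 => t At /osimplex_support; exact: At.
have f_v : u (path t) @[t --> 0^'+] --> mdot c v + e.
  apply: (@cvg_trans _ ((mdot c v + t * mdot c (w - v) + e) @[t --> 0^'+])).
    apply: near_eq_cvg; near=> t; rewrite uE; last by near: t.
    by rewrite /path mdotDr mdotZr.
  apply: cvg_at_right_filter; rewrite -[X in _ --> X + _]addr0.
  rewrite -[X in _ --> _ + X + _](mul0r (mdot c (w - v))).
  apply: cvgD; [apply: cvgD|]; [exact: cvg_cst| |exact: cvg_cst].
  by apply: cvgM; [exact: cvg_id|exact: cvg_cst].
exact: cvg_unique u_v f_v.
Unshelve. all: by end_near. Qed.

(** The only form in which membership in [Vh] enters what follows: it makes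
    integrands explicit polynomials in the reference coordinates and turns
    directional derivatives along edges into differences of vertex values. *)
Lemma Vh_bary S j u b : injective (vtx S j) -> Vh S u ->
  (forall a, 0 < b a) -> \sum_a b a = 1 ->
  u (\sum_a b a *: pos S (vtx S j a)) = \sum_a b a * u (pos S (vtx S j a)).
Proof.
move=> inj [ucont /(_ j)[c [e uE]]] b0 b1.
rewrite uE; last by apply/osimplexP => //; exists b.
under [RHS]eq_bigr do rewrite (Vh_affine_vertex inj ucont uE) mulrDr.
rewrite big_split/= -mulr_suml b1 mul1r mdot_sumr; congr (_ + _).
by apply: eq_bigr => a _; rewrite mdotZr.
Qed.

Lemma Vh_cst S (c : R) : Vh S (fun=> c).
Proof.
split=> [|j]; first by move=> x; exact: cvg_cst.
by exists 0, c => p _; rewrite /mdot mul0mx linear0 add0r.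
Qed.

Lemma Vh_coord S i : Vh S (fun p => p 0 i).
Proof.
split=> [|j].
  by apply: continuous_subspaceT => p; exact: coord_continuous.
exists (delta_mx 0 i), 0 => p _; rewrite addr0 /mdot -rowE /mxtrace big_ord1.
by rewrite !mxE.
Qed.

Lemma Vh_linear S (c : R) u v : Vh S u -> Vh S v ->
  Vh S (fun p => u p + c * v p).
Proof.
move=> [uc ua] [vc va]; split=> [|j].
  move=> p; apply: cvgD; first exact: uc.
  by apply: cvgM; [exact: cvg_cst|exact: vc].
have [a [e uE]] := ua j; have [a' [e' vE]] := va j.
exists (a + c *: a'), (e + c * e') => p pj; rewrite uE// vE//.
rewrite /mdot mulmxDl linearD -scalemxAl linearZ/=; ring.
Qed.

Lemma Vh_subr_cst S u (c : R) : Vh S u -> Vh S (fun p => u p - c).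
Proof.
move=> uV; have := Vh_linear (-1) uV (Vh_cst S c).
rewrite (_ : (fun _ => _) = fun p => u p - c)//.
by apply/funext => p; rewrite mulN1r.
Qed.

End AffineFunctions.

(** * Parametrization, surface gradient and Jacobian of a simplex *)

Section SimplexGeometry.
Context {R : realType} {n K J : nat}.
Implicit Types (S : surface R n K J) (j : 'I_J) (p : 'rV[R]_n.+1).
Implicit Types (u v : 'rV[R]_n.+1 -> R) (b : 'I_n.+1 -> R) (y : seq R).

Definition bary y (a : 'I_n.+1) : R :=
  if unlift ord0 a is Some i then y`_i else 1 - \sum_(i < n) y`_i.

Lemma bary0 y : bary y ord0 = 1 - \sum_(i < n) y`_i.
Proof. by rewrite /bary unlift_none. Qed.

Lemma bary_lift y i : bary y (lift ord0 i) = y`_i.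
Proof. by rewrite /bary liftK. Qed.

Lemma bary_sum1 y : \sum_a bary y a = 1.
Proof.
rewrite big_ord_recl; under eq_bigr do rewrite bary_lift.
by rewrite bary0 subrK.
Qed.

Lemma bary_gt0 y a : open_std_simplex n 1 y -> 0 < bary y a.
Proof.
move=> [szy y0 y1]; rewrite /bary; case: unliftP => [i _|_].
  by apply: (all_nthP 0 y0); rewrite szy.
by move: y1; rewrite (big_nth 0) szy big_mkord subr_gt0.
Qed.

Lemma paramE S j y : param S j y = \sum_a bary y a *: pos S (vtx S j a).
Proof.
rewrite big_ord_recl bary0 /param mulmx_sum_row.
under eq_bigr do rewrite mxE rowK scalerBr.
under [X in _ = _ + X]eq_bigr do rewrite bary_lift.
by rewrite sumrB -scaler_suml scalerBl scale1r addrA addrAC.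
Qed.

Lemma param_osimplex S j y : injective (vtx S j) ->
  open_std_simplex n 1 y -> osimplex S j (param S j y).
Proof.
move=> inj ys; apply/osimplexP => //; exists (bary y); split.
- by move=> a; exact: bary_gt0.
- exact: bary_sum1.
- exact: paramE.
Qed.

Lemma Vh_param S j u y : injective (vtx S j) -> Vh S u ->
  open_std_simplex n 1 y ->
  u (param S j y) = \sum_a bary y a * u (pos S (vtx S j a)).
Proof.
move=> inj uV ys; rewrite paramE; apply: Vh_bary => //.
  by move=> a; exact: bary_gt0.
exact: bary_sum1.
Qed.

Lemma polynomial_bary a : polynomial_fun n (fun y => bary y a).
Proof.
rewrite /bary; case: unlift => [i|]; first exact: polynomial_fun_coord.
apply: polynomial_funD; first exact: polynomial_fun_cst.
have [l lE] : polynomial_fun n (fun y => -1 * \sum_(i < n) y`_i).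
  apply: polynomial_funM; first exact: polynomial_fun_cst.
  by apply: polynomial_fun_sum => i; exact: polynomial_fun_coord.
by exists l => y; rewrite -mulN1r; exact: lE.
Qed.

Lemma polynomial_interp (c : 'I_n.+1 -> R) :
  polynomial_fun n (fun y => \sum_a bary y a * c a).
Proof.
apply: polynomial_fun_sum => a.
apply: polynomial_funM; first exact: polynomial_bary.
exact: polynomial_fun_cst.
Qed.

(** A displacement along an edge stays in the simplex and shifts weight from
    the base vertex to the other end of the edge, so that the difference
    quotient of the barycentric interpolant is eventually constant.  The values
    off the surface, where [u] is arbitrary, are never met. *)
Lemma derive_Vh_edge S j u p i : injective (vtx S j) -> Vh S u ->
  osimplex S j p ->
  'D_(row i (edges S j)) u p =
  u (pos S (vtx S j (lift ord0 i))) - u (pos S (vtx S j ord0)).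
Proof.
move=> inj uV /(osimplexP _ inj)[b [b0 b1 pE]].
set du := (RHS).
(* weights of the point displaced by h times the i-th edge *)
pose bh h a := b a + h * ((a == lift ord0 i)%:R - (a == ord0)%:R).
have sum_delta (M : lmodType R) (F : 'I_n.+1 -> M) a0 :
    \sum_a ((a == a0)%:R : R) *: F a = F a0.
  rewrite (bigD1 a0)//= eqxx scale1r big1 ?addr0// => a /negbTE ->.
  by rewrite scale0r.
have sum_bh (M : lmodType R) (F : 'I_n.+1 -> M) h : \sum_a bh h a *: F a =
    \sum_a b a *: F a + h *: (F (lift ord0 i) - F ord0).
  under eq_bigr do rewrite scalerDl -scalerA scalerBl.
  by rewrite big_split/= -scaler_sumr sumrB !sum_delta.
have bh1 h : \sum_a bh h a = 1.
  have := sum_bh R^o (fun=> 1) h; rewrite subrr scaler0 addr0.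
  under eq_bigr do rewrite /GRing.scale/= mulr1.
  under [in X in _ = X -> _]eq_bigr do rewrite /GRing.scale/= mulr1.
  by rewrite b1.
have pathE h : h *: row i (edges S j) + p = \sum_a bh h a *: pos S (vtx S j a).
  by rewrite sum_bh -pE addrC rowK.
have upath h : (forall a, 0 < bh h a) ->
    u (h *: row i (edges S j) + p) = u p + h * du.
  move=> bh0; rewrite pathE Vh_bary// pE Vh_bary//.
  exact: (sum_bh R^o (fun a => u (pos S (vtx S j a)))).
have bh_near : \forall h \near 0^', forall a, 0 < bh h a.
  apply: filter_forall => a.
  have bh_cvg : bh h a @[h --> (0 : R)^'] --> bh 0 a.
    apply: (@cvg_within_filter R R (bh^~ a) (nbhs (0 : R))).
    apply: cvgD; first exact: cvg_cst.
    by apply: cvgM; [exact: cvg_id|exact: cvg_cst].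
  by apply: (cvgr_gt _ bh_cvg); rewrite /bh mul0r addr0.
rewrite /derive; apply: cvg_lim => //.
apply: (@cvg_trans _ (du @[_ --> 0^'])); last exact: cvg_cst.
apply: near_eq_cvg; near=> h.
have h0 : h != 0 by near: h; exact: nbhs_dnbhs_neq.
rewrite /= upath; last by near: h.
by rewrite addrC addKr scalerA mulVf ?scale1r.
Unshelve. all: by end_near. Qed.

Lemma sgrad_subr_cst S j u (c : R) p :
  sgrad S (fun q => u q - c) j p = sgrad S u j p.
Proof.
suff E (e : 'rV[R]_n.+1) : 'D_e (fun q => u q - c) p = 'D_e u p.
  rewrite /sgrad (_ : (\row_i _) = \row_i 'D_(row i (edges S j)) u p)//.
  by apply/rowP => i; rewrite !mxE E.
rewrite /derive.
suff -> : (fun h : R => h^-1 *: (((fun q => u q - c) \o shift p) (h *: e) -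
    (u p - c))) = (fun h => h^-1 *: ((u \o shift p) (h *: e) - u p)) by [].
by apply/funext => h /=; rewrite opprB addrA subrK.
Qed.

Lemma mulmx_trE m (w : 'rV[R]_m) : (w *m w^T) 0 0 = \sum_k w 0 k ^+ 2.
Proof. by rewrite mxE; apply: eq_bigr => k _; rewrite mxE expr2. Qed.

Lemma mulmx_tr_ge0 m (w : 'rV[R]_m) : 0 <= (w *m w^T) 0 0.
Proof. by rewrite mulmx_trE sumr_ge0// => k _; exact: sqr_ge0. Qed.

Lemma mulmx_tr_eq0 m (w : 'rV[R]_m) : (w *m w^T) 0 0 = 0 -> w = 0.
Proof.
rewrite mulmx_trE => /psumr_eq0P w0; apply/rowP => k; rewrite mxE.
by apply/eqP; rewrite -sqrf_eq0; apply/eqP/w0 => // i _; exact: sqr_ge0.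
Qed.

Section Gram.
Variables (S : surface R n K J) (j : 'I_J).
Hypothesis free : row_free (edges S j).

Lemma gram_unit : gram S j \in unitmx.
Proof.
rewrite -row_free_unit -kermx_eq0; apply/eqP/row_matrixP => i; rewrite row0.
set v := row i _; have vG : v *m gram S j = 0.
  by apply/sub_kermxP; exact: row_sub.
have w0 : v *m edges S j = 0.
  apply: mulmx_tr_eq0.
  by rewrite trmx_mul mulmxA -(mulmxA v) vG mul0mx mxE.
by apply: (row_free_inj free); rewrite w0 mul0mx.
Qed.

(** Let [w] be a nonzero vector orthogonal to the edges.  Bordering the edges
    with [w] gives a square matrix [M], and [M *m M^T] is block diagonal with
    blocks [w *m w^T] and the Gram matrix; so the Gram determinant
    is the square of [\det M] divided by a positive number. *)
Lemma det_gram_ge0 : 0 <= \det (gram S j).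
Proof.
have [w w0 wE] : exists2 w : 'rV[R]_n.+1, w != 0 & w *m (edges S j)^T = 0.
  have : kermx (edges S j)^T != 0.
    (* the transposed edges form n.+1 rows of rank n *)
    rewrite kermx_eq0 /row_free mxrank_tr (eqP free) -[X in X == _]addn0.
    by rewrite -addn1 eqn_add2l.
  move/rowV0Pn => [w /sub_kermxP wE w0]; by exists w.
pose M : 'M[R]_(1 + n) := col_mx w (edges S j).
have w2 : 0 < (w *m w^T) 0 0.
  rewrite lt_neqAle mulmx_tr_ge0 andbT eq_sym.
  by apply: contraNneq w0 => /mulmx_tr_eq0 ->.
have detM : (\det M) ^+ 2 = (w *m w^T) 0 0 * \det (gram S j).
  rewrite expr2 -[X in _ * X]det_tr -det_mulmx tr_col_mx mul_col_row wE.
  rewrite (_ : edges S j *m w^T = 0); last first.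
    by rewrite -[LHS]trmxK trmx_mul trmxK wE trmx0.
  by rewrite (det_ublock _ 0) det_mx11.
by rewrite -(pmulr_rge0 _ w2) -detM sqr_ge0.
Qed.

End Gram.

(** Affine maps commute with barycentric interpolation. *)
Lemma param_image S j (w : 'rV[R]_n.+1 -> 'rV[R]_n.+1) y :
  injective (vtx S j) -> vec (Vh S) w -> open_std_simplex n 1 y ->
  w (param S j y) = param (image_surface w S) j y.
Proof.
move=> inj wV ys; rewrite (paramE (image_surface w S))/=.
apply/rowP => i; rewrite summxE.
rewrite (Vh_param inj (wV i) ys).
by apply: eq_bigr => a _; rewrite mxE.
Qed.

Lemma sjac_image S j (w : 'rV[R]_n.+1 -> 'rV[R]_n.+1) p :
  injective (vtx S j) -> vec (Vh S) w -> osimplex S j p ->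
  sjac S w j p =
  (edges (image_surface w S) j)^T *m invmx (gram S j) *m edges S j.
Proof.
move=> inj wV pj; apply/row_matrixP => i; rewrite rowK /sgrad !row_mul.
congr (_ *m _ *m _); apply/rowP => l; rewrite !mxE.
by rewrite (derive_Vh_edge _ inj (wV i) pj) ?mxE.
Qed.

(** With [E], [E'] the edges before and after [w], and [G], [G'] their Gram
    matrices, the surface Jacobian is [E'^T *m invmx G *m E]; in the basis of
    edges it induces [invmx G *m G'], whose determinant is the quotient of the
    two Gram determinants. *)
Lemma area_image S j (w : 'rV[R]_n.+1 -> 'rV[R]_n.+1) p :
  injective (vtx S j) -> row_free (edges S j) -> vec (Vh S) w ->
  osimplex S j p ->
  Num.sqrt (\det (gram S j)) * sjacobian_det S w j p =
  Num.sqrt (\det (gram (image_surface w S) j)).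
Proof.
move=> inj free wV pj; have Gu := gram_unit free.
rewrite /sjacobian_det -sqrtrM ?det_gram_ge0//; congr Num.sqrt.
rewrite -det_mulmx /tangent_mx (mulKVmx Gu) /gram; congr (\det _).
have sjacE : sjac S w j p *m (edges S j)^T = (edges (image_surface w S) j)^T.
  by rewrite sjac_image// -mulmxA -/(gram S j) -mulmxA mulVmx// mulmx1.
rewrite mulmxA -mulmxA sjacE -[X in X *m _]trmxK trmx_mul trmxK sjacE.
by rewrite trmxK.
Qed.

End SimplexGeometry.

(** * Surface integrals *)

Section SurfaceIntegral.
Context {R : realType} {n K J : nat}.
Implicit Types (S : surface R n K J) (j : 'I_J).

Lemma eq_sint S (f g : 'I_J -> 'rV[R]_n.+1 -> R) :
  (forall j p, f j p = g j p) -> sint S f = sint S g.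
Proof.
by move=> fg; congr sint; apply/funext => j; apply/funext => p; exact: fg.
Qed.

Lemma L2C S (u v : 'I_J -> 'rV[R]_n.+1 -> R) : L2 S u v = L2 S v u.
Proof. by apply: eq_sint => j p; rewrite mulrC. Qed.

Lemma L2norm_sqr S (u : 'rV[R]_n.+1 -> R) :
  L2norm S u ^+ 2 = L2 S (fun=> u) (fun=> u).
Proof.
rewrite sqr_sqrtr//; apply: sumr_ge0 => j _.
rewrite mulr_ge0 ?sqrtr_ge0//; apply: std_simplex_int_ge0 => // y _.
by rewrite -expr2 sqr_ge0.
Qed.

(** The difference of the two sides is the integral of half the square of
    [X - r g]; this is Young's inequality on one simplex, where the square root
    [r] of the Jacobian is constant. *)
Lemma young_std_simplex_int (X g : seq R -> R) (r dt : R) : 0 < dt ->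
  polynomial_fun n X -> polynomial_fun n g ->
  2^-1 * std_simplex_int n 1 (fun y => X y * X y) <=
  dt * std_simplex_int n 1 (fun y => (X y - g y * r) / dt * X y) +
  2^-1 * (r ^+ 2 * std_simplex_int n 1 (fun y => g y * g y)).
Proof.
move=> dt0 Xpol gpol.
have int (f : seq R -> R) : polynomial_fun n f -> iter_integrable n 1 f.
  exact: polynomial_fun_integrable.
have XX := int _ (polynomial_funM Xpol Xpol).
have gg := int _ (polynomial_funM gpol gpol).
have XgX : iter_integrable n 1 (fun y => (X y - g y * r) / dt * X y).
  have pol (c : R) := polynomial_fun_cst n c.
  have [l lE] := polynomial_funM (polynomial_funM
    (polynomial_funD Xpol (polynomial_funM gpol (pol (- r)))) (pol dt^-1)) Xpol.
  by apply: int; exists l => y; rewrite -lE mulrN.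
have [iX <-] := std_simplex_intZ 2^-1 ltr01 XX.
have [ig <-] := std_simplex_intZ (r ^+ 2) ltr01 gg.
have [ig2 <-] := std_simplex_intZ 2^-1 ltr01 ig.
have [iR <-] := std_simplex_int_linear dt ltr01 XgX ig2.
apply: le_std_simplex_int => // y _.
rewrite -subr_ge0.
have -> : dt * ((X y - g y * r) / dt * X y) + 2^-1 * (r ^+ 2 * (g y * g y)) -
  2^-1 * (X y * X y) = 2^-1 * (X y - r * g y) ^+ 2.
  by field; rewrite gt_eqF.
by rewrite mulr_ge0 ?invr_ge0 ?sqr_ge0.
Qed.

End SurfaceIntegral.

(** * The energy estimate *)

Section Scheme.
Context {R : realType} {n K J : nat}.
Variables (kbar dt : R) (D1 D2 : set 'rV[R]_n.+1) (s : scheme_data R n K J).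
Variable M : nat.
Hypothesis dt_gt0 : 0 < dt.
Hypothesis hs : scheme_solution kbar dt D1 D2 s M.
Implicit Types m : nat.

Lemma solution_nondegenerate m : (m < M)%N -> Defs.nondegenerate (Gam s m).
Proof. by case: hs => _ _ h /h[[[]]]. Qed.

Lemma solution_vtx_inj m j : (m < M)%N -> injective (vtx (Gam s m) j).
Proof. by move=> /solution_nondegenerate[_ /(_ j)[]]. Qed.

Lemma solution_row_free m j : (m < M)%N -> row_free (edges (Gam s m) j).
Proof. by move=> /solution_nondegenerate[_ /(_ j)[]]. Qed.

Lemma solution_vkS_Vh m : (m < M)%N ->
  Vh (Gam s m) (fun p => vk s m.+1 p - kbar).
Proof.
by case: hs => _ _ h /h[_ _ _ [[_ [kV _] _ _] _] _]; exact: Vh_subr_cst.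
Qed.

Lemma solution_vk_Vh m : (m < M)%N ->
  Vh (Gam s m.-1) (fun p => vk s m p - kbar).
Proof.
case: m => [_|m /ltnW]; last exact: solution_vkS_Vh.
by case: hs => _ [[k0 _] _] _; exact: Vh_subr_cst.
Qed.

Lemma Phi_Vh m : (m < M)%N -> vec (Vh (Gam s m)) (Phi dt s m).
Proof.
case: hs => _ _ h /h[_ _ [velV _] _ _] i.
rewrite /= (_ : (fun _ => _) =
    fun p : 'rV[R]_n.+1 => p 0 i + (- dt) * vel s m p 0 i).
  by apply: Vh_linear; [exact: Vh_coord|exact: velV].
by apply/funext => p; rewrite !mxE mulNr.
Qed.

Lemma image_Phi m : (m.+1 < M)%N ->
  image_surface (Phi dt s m.+1) (Gam s m.+1) = Gam s m.
Proof.
case: hs => _ _ h mM; have [_ _ [_ velE] _ _] := h _ mM.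
have [_ _ _ _ GE] := h _ (ltnW mM).
rewrite /image_surface; case E : (Gam s m) => [v0 p0]; congr Surface.
  by rewrite GE E.
apply/funext => k; rewrite /Phi velE/= E/= scalerA divff ?gt_eqF// scale1r.
by rewrite opprB addrC subrK.
Qed.

Lemma vkG_param m j y : (m < M)%N -> open_std_simplex n 1 y ->
  vkG dt s m (param (Gam s m) j y) = vk s m (param (Gam s m.-1) j y).
Proof.
case: m => [//|m] mM ys; rewrite /vkG (param_image _ (Phi_Vh mM) ys).
  by rewrite image_Phi.
exact: solution_vtx_inj.
Qed.

(** At [m = 0] both surfaces are the initial one and the Jacobian is [1], so
    that the first step is an instance of the general one. *)
Lemma area_Jac m j p : (m < M)%N -> osimplex (Gam s m) j p ->
  Num.sqrt (\det (gram (Gam s m) j)) * Jac dt s m j p =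
  Num.sqrt (\det (gram (Gam s m.-1) j)).
Proof.
case: m => [|m] mM pj; first by rewrite mulr1.
rewrite /Jac area_image ?image_Phi//.
- exact: solution_vtx_inj.
- exact: solution_row_free.
- exact: Phi_Vh.
Qed.

(** The cancellation is purely algebraic: each mixed term occurs in both
    equations with the same integrand up to commutativity, and subtracting the
    constant [kbar] does not change a gradient. *)
Lemma energy_identity m : (m < M)%N ->
  let G := Gam s m in let chi p := vk s m.+1 p - kbar in
  L2 G (fun j p => (chi p - (vkG dt s m p - kbar) * Num.sqrt (Jac dt s m j p))
                     / dt) (fun=> chi)
  + L2 G (fun=> V s m.+1) (fun=> V s m.+1) = 0.
Proof.
case: hs => _ _ h /h[_ _ _ [[V0 [kV k1] eq1 eq2] _] _] G chi.
have chiV : Vh_on G D1 chi.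
  split=> [|p Dp]; [exact: Vh_subr_cst|by rewrite /chi k1 ?subrr].
move: (eq1 _ V0) (eq2 _ chiV); rewrite /antisym subrr mulr0 subr0.
rewrite -/G -/chi.
have -> : L2m G (sgrad G (V s m.+1)) (sgrad G chi) =
          L2m G (sgrad G (vk s m.+1)) (sgrad G (V s m.+1)).
  apply: eq_sint => j p; rewrite sgrad_subr_cst.
  by rewrite /mdot -[LHS]mxtrace_tr trmx_mul trmxK.
have -> : L2 G (fun j p => Wm s m j p * V s m.+1 p) (fun=> chi) =
          L2 G (fun j p => Wm s m j p * chi p) (fun=> V s m.+1).
  by apply: eq_sint => j p; rewrite mulrAC.
rewrite (L2C G (fun=> V s m.+1) (fun _ p => _ * _ * chi p)).
rewrite /chi; lra.
Qed.

Lemma energy_decrease m : (m < M)%N ->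
  2^-1 * L2norm (Gam s m) (fun p => vk s m.+1 p - kbar) ^+ 2
    + dt * L2norm (Gam s m) (V s m.+1) ^+ 2
  <= 2^-1 * L2norm (Gam s m.-1) (fun p => vk s m p - kbar) ^+ 2.
Proof.
move=> mM; have := energy_identity mM => /=.
rewrite !L2norm_sqr => /eqP; rewrite addrC addr_eq0 => /eqP ->.
rewrite mulrN lerBlDr [leRHS]addrC /L2 /sint !mulr_sumr -big_split/=.
apply: ler_sum => j _.
have inj := @solution_vtx_inj m j mM.
set a := Num.sqrt (\det (gram (Gam s m) j)).
set a' := Num.sqrt (\det (gram (Gam s m.-1) j)).
have a0 : 0 < a.
  rewrite sqrtr_gt0 lt_neqAle det_gram_ge0 ?solution_row_free// andbT eq_sym.
  by rewrite -unitfE -unitmxE gram_unit// solution_row_free.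
(* by area_Jac, the Jacobian is constant on the simplex, equal to a' / a *)
pose r := Num.sqrt (a' / a).
have r2 : r ^+ 2 = a' / a by rewrite sqr_sqrtr// divr_ge0// sqrtr_ge0.
have JacE y : open_std_simplex n 1 y ->
    Num.sqrt (Jac dt s m j (param (Gam s m) j y)) = r.
  move=> ys; rewrite /r -[a'](area_Jac mM (param_osimplex inj ys)) -/a.
  by rewrite mulrC mulKf// gt_eqF.
set chi := fun p => vk s m.+1 p - kbar.
set chi0 := fun p => vk s m p - kbar.
pose Xi y := \sum_b bary y b * chi (pos (Gam s m) (vtx (Gam s m) j b)).
pose gi y := \sum_b bary y b * chi0 (pos (Gam s m.-1) (vtx (Gam s m.-1) j b)).
have XE y : open_std_simplex n 1 y -> chi (param (Gam s m) j y) = Xi y.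
  exact: Vh_param (solution_vkS_Vh mM).
have gE y : open_std_simplex n 1 y -> chi0 (param (Gam s m.-1) j y) = gi y.
  apply: Vh_param (solution_vk_Vh mM); apply: solution_vtx_inj.
  exact: leq_ltn_trans (leq_pred m) mM.
have vE y : open_std_simplex n 1 y ->
    vkG dt s m (param (Gam s m) j y) - kbar = gi y.
  by move=> ys; rewrite vkG_param// -gE.
have IX : std_simplex_int n 1 (fun y => chi (param (Gam s m) j y) *
    chi (param (Gam s m) j y)) = std_simplex_int n 1 (fun y => Xi y * Xi y).
  by apply: eq_std_simplex_int => // y ys; rewrite XE.
have Ig : std_simplex_int n 1 (fun y => chi0 (param (Gam s m.-1) j y) *
    chi0 (param (Gam s m.-1) j y)) = std_simplex_int n 1 (fun y => gi y * gi y).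
  by apply: eq_std_simplex_int => // y ys; rewrite gE.
have IXg : std_simplex_int n 1 (fun y => (chi (param (Gam s m) j y) -
    (vkG dt s m (param (Gam s m) j y) - kbar) *
    Num.sqrt (Jac dt s m j (param (Gam s m) j y))) / dt *
    chi (param (Gam s m) j y)) =
    std_simplex_int n 1 (fun y => (Xi y - gi y * r) / dt * Xi y).
  by apply: eq_std_simplex_int => // y ys; rewrite XE// vE// JacE.
rewrite IX Ig IXg.
have := young_std_simplex_int r dt_gt0
  (polynomial_interp _ : polynomial_fun n Xi)
  (polynomial_interp _ : polynomial_fun n gi).
rewrite r2 -(ler_pM2l a0); set rho := a' / a.
have -> : a' = a * rho by rewrite mulrC divfK// gt_eqF.
by rewrite -mulrA mulrDr !(mulrCA a).
Qed.

End Scheme.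

Unset Implicit Arguments.

Theorem theorem4p3 (R : realType) (n K J : nat)
    (hd : n.+1 = 2%N \/ n.+1 = 3%N)
    (kbar T : R) (hT : 0 < T) (M : nat) (hM : (0 < M)%N)
    (D1 D2 : set 'rV[R]_n.+1) (s : scheme_data R n K J)
    (hs : scheme_solution kbar (T / M%:R) D1 D2 s M) :
  forall m : nat, (m < M)%N ->
    2^-1 * L2norm (Gam s m) (fun p => vk s m.+1 p - kbar) ^+ 2
      + T / M%:R * L2norm (Gam s m) (V s m.+1) ^+ 2
    <= 2^-1 * L2norm (Gam s m.-1) (fun p => vk s m p - kbar) ^+ 2.
Proof.
have dt_gt0 : 0 < T / M%:R by rewrite divr_gt0 ?ltr0n.
by move=> m mM; exact: energy_decrease dt_gt0 hs _ mM.
Qed.
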